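(* Let $\pi$ be a prior distribution for $\boldsymbol\mu$ with (generalized) Bayes estimator $\widehat{\boldsymbol\mu}^B=E^{\pi}[\boldsymbol\mu\,|\,\mathbf y]\in\Gamma$. Suppose that either (a) $\mathbf W'E^{\pi}[\boldsymbol\mu\,|\,\mathbf y]=\mathbf t(\mathbf y)$, or (b) $E^{\pi}[\boldsymbol\xi_2\,|\,\mathbf y]=\mathbf H_2\mathbf Q^{-1/2}\mathbf W(\mathbf W'\mathbf Q^{-1}\mathbf W)^{-1}\mathbf t(\mathbf y)$, where in the case $\mathbf t(\mathbf y)=\mathbf W'\mathbf Q^{-1/2}\mathbf s(\mathbf y)$ for a $k$-variate function $\mathbf s(\mathbf y)$, condition (b) simplifies to $E^{\pi}[\boldsymbol\xi_2\,|\,\mathbf y]=\mathbf H_2\mathbf s(\mathbf y)$. Then the unconstrained Bayes estimator $\widehat{\boldsymbol\mu}^B$ belongs to $\Gamma_C$; that is, it automatically satisfies the constraint $\mathbf W'\widehat{\boldsymbol\mu}^B=\mathbf t(\mathbf y)$.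
   Context: Model: $\mathbf y=\boldsymbol\mu+\boldsymbol\epsilon$, where $\mathbf y,\boldsymbol\mu,\boldsymbol\epsilon\in\mathbb R^k$, $\boldsymbol\mu$ is an unknown mean vector and $\boldsymbol\epsilon$ is a random error vector (normality is not assumed). $\mathbf Q$ is a fixed $k\times k$ (symmetric) positive definite matrix with symmetric square root $\mathbf Q^{1/2}$; $\mathbf W$ is a fixed $k\times m$ matrix of rank $m$, $m<k$; $\mathbf t=\mathbf t(\mathbf y)$ is a given function from $\mathbb R^k$ to $\mathbb R^m$. $E^{\pi}[\cdot\,|\,\mathbf y]$ denotes posterior expectation under the prior $\pi$. $\Gamma$ is the class of estimators $\widehat{\boldsymbol\mu}=\widehat{\boldsymbol\mu}(\mathbf y)$ of $\boldsymbol\mu$ with $E[\widehat{\boldsymbol\mu}'\widehat{\boldsymbol\mu}\,|\,\boldsymbol\mu]<\infty$. The constrained estimator based on $\widehat{\boldsymbol\mu}$ is $$\widehat{\boldsymbol\mu}^{C}(\widehat{\boldsymbol\mu},\mathbf t)=\widehat{\boldsymbol\mu}+\mathbf Q^{-1}\mathbf W(\mathbf W'\mathbf Q^{-1}\mathbf W)^{-1}\{\mathbf t(\mathbf y)-\mathbf W'\widehat{\boldsymbol\mu}\},$$ and $\Gamma_C=\{\widehat{\boldsymbol\mu}^{C}(\widehat{\boldsymbol\mu},\mathbf t)\,|\,\widehat{\boldsymbol\mu}\in\Gamma\}$. $\mathbf H$ is a $k\times k$ orthogonal matrix such that $$\mathbf H\mathbf Q^{-1/2}\mathbf W(\mathbf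 W'\mathbf Q^{-1}\mathbf W)^{-1}\mathbf W'\mathbf Q^{-1/2}\mathbf H'=\begin{pmatrix}\mathbf 0_{k-m}&\mathbf 0\\ \mathbf 0&\mathbf I_m\end{pmatrix},$$ partitioned as $\mathbf H'=(\mathbf H_1',\mathbf H_2')$ where $\mathbf H_1$ consists of the first $k-m$ rows and $\mathbf H_2$ of the last $m$ rows of $\mathbf H$; $\boldsymbol\xi_i=\mathbf H_i\mathbf Q^{1/2}\boldsymbol\mu$, $i=1,2$. *)

(* Defs.v *)
From HB Require Import structures.
From mathcomp Require Import all_boot all_order all_algebra.
From mathcomp Require Import all_classical all_reals all_analysis.

Set Implicit Arguments.
Unset Strict Implicit.
Unset Printing Implicit Defensive.

Import Order.TTheory GRing.Theory Num.Theory.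
Import numFieldNormedType.Exports.

Local Open Scope classical_set_scope.
Local Open Scope ring_scope.

(** Matrices over [R], in particular [R^k = 'cV[R]_k], carry the Borel
    sigma-algebra. *)
HB.instance Definition _ (R : realType) (m n : nat) :=
  Measurable.copy 'M[R]_(m, n) (g_sigma_algebraType (@open 'M[R]_(m, n))).

Definition posdefmx (R : realType) (k : nat) (Q : 'M[R]_k) : Prop :=
  Q^T = Q /\ forall v : 'cV[R]_k, v != 0 -> 0 < (v^T *m Q *m v) 0 0.

(** Any symmetric square root is allowed; the positive definite one is a
    particular case. *)
Definition symmetric_sqrtmx (R : realType) (k : nat) (Q Qh : 'M[R]_k) : Prop :=
  Qh^T = Qh /\ Qh *m Qh = Q.

Definition orthogonalmx (R : realType) (k : nat) (H : 'M[R]_k) : Prop :=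
  H *m H^T = 1%:M.

(** Cast exposing the first [k - m] and the last [m] rows of [H], that is,
    [H1 = usubmx (split_rows lemk H)] and [H2 = dsubmx (split_rows lemk H)]. *)
Definition split_rows (R : realType) (k m : nat) (lemk : (m <= k)%N)
    (H : 'M[R]_k) : 'M[R]_(k - m + m, k) :=
  castmx (esym (subnK lemk), erefl k) H.

Definition vintegrable (R : realType) (k n : nat)
    (P : {measure set 'cV[R]_k -> \bar R}) (g : 'cV[R]_k -> 'cV[R]_n) : Prop :=
  forall i, P.-integrable setT (EFin \o (fun x => g x i 0)).

Definition vexpectation (R : realType) (k n : nat)
    (P : {measure set 'cV[R]_k -> \bar R}) (g : 'cV[R]_k -> 'cV[R]_n) :
    'cV[R]_n :=
  \col_i Rintegral P setT (fun x => g x i 0).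

(** The model [y = mu + eps]: [err mu] is the conditional law of [eps] given
    [mu], hence [y] given [mu] is distributed as [mu + e] with [e ~ err mu].
    An error law that does not depend on [mu] is a constant kernel.
    This predicate says that [mu] is the mean vector of [y]. *)
Definition mean_vector_model (R : realType) (k : nat)
    (err : R.-pker 'cV[R]_k ~> 'cV[R]_k) : Prop :=
  forall mu : 'cV[R]_k,
    vintegrable (err mu) (fun e => mu + e) /\
    vexpectation (err mu) (fun e => mu + e) = mu.

(** [post] is a (formal) posterior of [mu] given [y] under the possibly
    improper prior [prior]: the joint measure of [(mu, y)] disintegrates as
    [post y (dmu) marg (dy)]. Taking [B = setT] shows that [marg] is the marginal
    measure of [y]; its sigma-finiteness is what makes an improper prior admit
    a genuine posterior. *)
Definition is_posterior (R : realType) (k : nat)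
    (prior : {sigma_finite_measure set 'cV[R]_k -> \bar R})
    (err post : R.-pker 'cV[R]_k ~> 'cV[R]_k) : Prop :=
  exists marg : {sigma_finite_measure set 'cV[R]_k -> \bar R},
    forall A B : set 'cV[R]_k, measurable A -> measurable B ->
      (\int[prior]_(mu in B) err mu [set e | A (mu + e)%R]
       = \int[marg]_(y in A) post y B)%E.

(** [muB y = E[mu | y]], including the existence of the posterior mean. *)
Definition is_bayes_estimator (R : realType) (k : nat)
    (post : R.-pker 'cV[R]_k ~> 'cV[R]_k) (muB : 'cV[R]_k -> 'cV[R]_k) : Prop :=
  forall y, vintegrable (post y) (fun mu => mu) /\
            muB y = vexpectation (post y) (fun mu => mu).

Definition Gamma (R : realType) (k : nat)
    (err : R.-pker 'cV[R]_k ~> 'cV[R]_k) : set ('cV[R]_k -> 'cV[R]_k) :=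
  [set muhat | measurable_fun setT muhat /\
     forall mu : 'cV[R]_k,
       (\int[err mu]_e
          (((muhat (mu + e))^T *m muhat (mu + e)) 0 0)%R%:E < +oo)%E].

Definition constrained (R : realType) (k m : nat) (Q : 'M[R]_k)
    (W : 'M[R]_(k, m)) (t : 'cV[R]_k -> 'cV[R]_m) (muhat : 'cV[R]_k -> 'cV[R]_k) :
    'cV[R]_k -> 'cV[R]_k :=
  fun y => muhat y + invmx Q *m W *m invmx (W^T *m invmx Q *m W)
             *m (t y - W^T *m muhat y).

Definition GammaC (R : realType) (k m : nat)
    (err : R.-pker 'cV[R]_k ~> 'cV[R]_k) (Q : 'M[R]_k) (W : 'M[R]_(k, m))
    (t : 'cV[R]_k -> 'cV[R]_m) : set ('cV[R]_k -> 'cV[R]_k) :=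
  [set constrained Q W t muhat | muhat in Gamma err].

Definition condition_a (R : realType) (k m : nat)
    (post : R.-pker 'cV[R]_k ~> 'cV[R]_k) (W : 'M[R]_(k, m))
    (t : 'cV[R]_k -> 'cV[R]_m) : Prop :=
  forall y, W^T *m vexpectation (post y) (fun mu => mu) = t y.

Definition xi2 (R : realType) (k m : nat) (Qh : 'M[R]_k) (H2 : 'M[R]_(m, k)) :
    'cV[R]_k -> 'cV[R]_m :=
  fun mu => H2 *m Qh *m mu.

Definition condition_b (R : realType) (k m : nat)
    (post : R.-pker 'cV[R]_k ~> 'cV[R]_k) (Q Qh : 'M[R]_k)
    (W : 'M[R]_(k, m)) (H2 : 'M[R]_(m, k)) (t : 'cV[R]_k -> 'cV[R]_m) : Prop :=
  forall y, vexpectation (post y) (xi2 Qh H2)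
    = H2 *m invmx Qh *m W *m invmx (W^T *m invmx Q *m W) *m t y.

(* Main.v *)
Require Import Defs.
From mathcomp Require Import all_boot all_order all_algebra.
From mathcomp Require Import all_classical all_reals all_analysis.

Set Implicit Arguments.
Unset Strict Implicit.
Unset Printing Implicit Defensive.

Import Order.TTheory GRing.Theory Num.Theory.
Import numFieldNormedType.Exports.

Local Open Scope classical_set_scope.
Local Open Scope ring_scope.

(** With [V = Qh^-1 W] and [N = W^T Q^-1 W = V^T V], the matrix diagonalized by
    [H] is the orthogonal projection [P = V N^-1 V^T] onto the column space of
    [V], and the diagonal form says that the rows of [H2] are an orthonormal
    basis of that space: [H2 H2^T = 1], [P = H2^T H2] and [H2 P = H2]
    ([dsubmx_block_projection]). Hence:

    - if [t = V^T s], the right-hand side of (b) is [H2 V N^-1 V^T s = H2 P s],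
      which is [H2 s];

    - the posterior mean is linear ([vexpectation_mulmx]), so (b) reads
      [H2 Qh muB = H2 V N^-1 t]. Multiplying by [V^T H2^T] turns [H2^T H2] into
      [P], and [V^T P = V^T], which holds because [N] is invertible
      ([unitmx_of_block_projection]), leaves [V^T Qh muB = t], that is,
      [W^T muB = t]: (b) implies (a) ([constraint_of_projection]).

    Finally, an estimator that satisfies the constraint is its own constrained
    version, so a Bayes estimator in [Gamma] that satisfies it is in
    [GammaC]. *)

Lemma vexpectation_mulmx (R : realType) (k n p : nat)
  (P : {measure set 'cV[R]_k -> \bar R}) (A : 'M[R]_(p, n))
  (g : 'cV[R]_k -> 'cV[R]_n) :
  vintegrable P g ->
  vexpectation P (fun x => A *m g x) = A *m vexpectation P g.
Proof.
move=> ig; apply/matrixP => i j; rewrite ord1 {j} !mxE /Rintegral.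
have iAg l : P.-integrable setT (fun x => (A i l)%:E * (g x l 0)%:E)%E.
  exact: integrableZl (ig l).
under eq_integral do rewrite mxE -sumEFin.
rewrite integral_sum//.
have int l : (\int[P]_x ((A i l)%:E * (g x l 0)%:E))%E
             = (A i l * Rintegral P setT (fun x => g x l 0))%:E.
  rewrite (integralZl measurableT (ig l)) EFinM fineK//.
  exact: integrable_fin_num (ig l).
under eq_bigr do rewrite int.
by rewrite sumEFin; apply: eq_bigr => l _; rewrite mxE.
Qed.

(** A row vector [v] in the left kernel of [Q] has [v Q v^T = 0]. *)
Lemma posdefmx_unit (R : realType) (k : nat) (Q : 'M[R]_k) :
  posdefmx Q -> Q \in unitmx.
Proof.
move=> [_ Qpos]; rewrite -row_free_unit -kermx_eq0.
apply/rowV0P => v /sub_kermxP vQ0; apply/eqP/negPn/negP => v0.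
have := Qpos v^T; rewrite trmx_eq0 => /(_ v0).
by rewrite trmxK vQ0 mul0mx mxE ltxx.
Qed.

Lemma split_rows_orthogonal (R : realType) (k m : nat) (lemk : (m <= k)%N)
  (H : 'M[R]_k) :
  orthogonalmx H -> (split_rows lemk H)^T *m split_rows lemk H = 1%:M.
Proof.
move=> /mulmx1C HH; rewrite /split_rows.
by case: _ / (esym (subnK lemk)); rewrite castmx_id.
Qed.

(** Here [A] plays the role of [H], in a shape exposing its two row blocks.
    Since [A^T A = 1], the diagonal form [A P A^T = D] gives [A P = D A] and
    [P = A^T D A], and [D] kills the upper block. The last conclusion is the
    lower right block of [D = (D A) A^T]. *)
Lemma dsubmx_block_projection (R : comPzRingType) (k r m : nat)
  (A : 'M[R]_(r + m, k)) (P : 'M[R]_k) :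
  A^T *m A = 1%:M ->
  A *m P *m A^T = block_mx (0 : 'M[R]_r) 0 0 1%:M ->
  [/\ dsubmx A *m P = dsubmx A, (dsubmx A)^T *m dsubmx A = P
    & dsubmx A *m (dsubmx A)^T = 1%:M].
Proof.
move=> AA AP; set A2 := dsubmx A.
have APE : A *m P = col_mx 0 A2.
  rewrite -[LHS]mulmx1 -AA mulmxA AP -[X in _ *m X]vsubmxK mul_block_col.
  by rewrite !mul0mx !mul1mx addr0 add0r.
have AT : A^T = row_mx (usubmx A)^T A2^T by rewrite -tr_col_mx vsubmxK.
split; first by rewrite mul_dsub_mx APE col_mxKd.
  by rewrite -[RHS]mul1mx -AA -mulmxA APE AT mul_row_col mulmx0 add0r.
by move: AP; rewrite APE AT mul_col_row => /eq_block_mx[].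
Qed.

(** The block [1%:M] has full size [m]: it factors through the [m * m] matrix
    [N^-1], which is therefore invertible. *)
Lemma unitmx_of_block_projection (R : comUnitRingType) (k m : nat)
  (V : 'M[R]_(k, m)) (N : 'M[R]_m) (B : 'M[R]_(m, k)) :
  B *m (V *m invmx N *m V^T) *m B^T = 1%:M -> N \in unitmx.
Proof.
rewrite -!mulmxA mulmxA => /mulmx1_unit[_].
by rewrite unitmx_mul unitmx_inv => /andP[].
Qed.

(** Multiplying on the left by [V^T B^T] replaces [B^T B] by the orthogonal
    projection onto the column space of [V], which [V^T] absorbs. *)
Lemma constraint_of_projection (R : comUnitRingType) (k m n : nat)
  (V : 'M[R]_(k, m)) (B : 'M[R]_(n, k)) (x : 'cV[R]_k) (u : 'cV[R]_m) :
  let N := V^T *m V in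
  N \in unitmx -> B^T *m B = V *m invmx N *m V^T ->
  B *m x = B *m (V *m invmx N *m u) -> V^T *m x = u.
Proof.
move=> N Nu BB Bx.
have VBB : V^T *m B^T *m B = V^T.
  by rewrite -mulmxA BB !mulmxA mulmxV// mul1mx.
rewrite -VBB -mulmxA Bx 2!mulmxA VBB !mulmxA -/N.
by rewrite mulmxV// mul1mx.
Qed.

Lemma constrained_id (R : realType) (k m : nat) (Q : 'M[R]_k)
  (W : 'M[R]_(k, m)) (t : 'cV[R]_k -> 'cV[R]_m)
  (muhat : 'cV[R]_k -> 'cV[R]_k) :
  (forall y, W^T *m muhat y = t y) -> constrained Q W t muhat = muhat.
Proof.
by move=> Wt; apply/funext => y; rewrite /constrained Wt subrr mulmx0 addr0.
Qed.

Theorem proposition2p5 (R : realType) (k m : nat) (ltmk : (m < k)%N)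
  (Q Qh : 'M[R]_k) (W : 'M[R]_(k, m)) (H : 'M[R]_k)
  (t : 'cV[R]_k -> 'cV[R]_m)
  (err : R.-pker 'cV[R]_k ~> 'cV[R]_k)
  (prior : {sigma_finite_measure set 'cV[R]_k -> \bar R})
  (post : R.-pker 'cV[R]_k ~> 'cV[R]_k)
  (muB : 'cV[R]_k -> 'cV[R]_k)
  (HQ : posdefmx Q) (HQh : symmetric_sqrtmx Q Qh) (HW : \rank W = m)
  (Horth : orthogonalmx H)
  (Hdiag : let Hs := split_rows (ltnW ltmk) H in
     Hs *m (invmx Qh *m W *m invmx (W^T *m invmx Q *m W) *m W^T *m invmx Qh)
        *m Hs^T
     = block_mx (0 : 'M[R]_(k - m)) 0 0 1%:M)
  (Hmodel : mean_vector_model err)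
  (Hpost : is_posterior prior err post)
  (HmuB : is_bayes_estimator post muB)
  (HGamma : Gamma err muB) :
  let H2 := dsubmx (split_rows (ltnW ltmk) H) in
  (forall s : 'cV[R]_k -> 'cV[R]_k,
     (forall y, t y = W^T *m invmx Qh *m s y) ->
     (condition_b post Q Qh W H2 t <->
      forall y, vexpectation (post y) (xi2 Qh H2) = H2 *m s y)) /\
  (condition_a post W t \/ condition_b post Q Qh W H2 t ->
     GammaC err Q W t muB /\ forall y, W^T *m muB y = t y).
Proof.
set Hs := split_rows _ _ => H2; case: HQh => QhT QhQh.
have /andP[Qhu _] : (Qh \in unitmx) && (Qh \in unitmx).
  by rewrite -unitmx_mul QhQh posdefmx_unit.
set V := invmx Qh *m W; set N := V^T *m V.
have VT : V^T = W^T *m invmx Qh by rewrite trmx_mul trmx_inv QhT.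
have NE : W^T *m invmx Q *m W = N.
  suff -> : invmx Q = invmx Qh *m invmx Qh by rewrite /N VT !mulmxA.
  rewrite -[RHS](mulmxK (posdefmx_unit HQ)) -[in X in _ *m X *m _]QhQh.
  by rewrite mulmxA mulmxKV// mulVmx// mul1mx.
have PE : invmx Qh *m W *m invmx (W^T *m invmx Q *m W) *m W^T *m invmx Qh
          = V *m invmx N *m V^T by rewrite NE -/V VT !mulmxA.
have [H2P H2H2 H2o] := dsubmx_block_projection
  (split_rows_orthogonal (ltnW ltmk) Horth) Hdiag.
rewrite -/Hs -/H2 PE in H2P H2H2.
have H2V y : H2 *m invmx Qh *m W *m invmx (W^T *m invmx Q *m W) *m t y
             = H2 *m (V *m invmx N *m t y) by rewrite NE /V !mulmxA.
split=> [s ts|abcond].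
  have bE y : H2 *m (V *m invmx N *m t y) = H2 *m s y.
    by rewrite ts -VT [_ *m (V^T *m _)]mulmxA mulmxA H2P.
  by split=> b y; rewrite b H2V bE.
have WmuB y : W^T *m muB y = t y.
  have [imu ->] := HmuB y.
  case: abcond => [a|b]; first exact: a.
  have Nu : N \in unitmx.
    by apply: (@unitmx_of_block_projection _ _ _ V N H2); rewrite H2P.
  have -> : W^T = V^T *m Qh by rewrite VT mulmxKV.
  rewrite -mulmxA; apply: (constraint_of_projection Nu H2H2).
  by rewrite -H2V -b mulmxA vexpectation_mulmx.
split=> //; exists muB => //; exact: constrained_id.
Qed.
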